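(* A class of graphs $\mathcal{X}$ is a function of $\mathcal{E}_1$ if and only if there exists a constant $t$ such that every graph in $\mathcal{X}$ has at most $t$ edges or at most $t$ non-edges.
   Context: All graphs are finite and simple; a class of graphs is a set of graphs closed under isomorphism. $\mathcal{E}_1$ is the class of graphs with at most one edge. For a graph $G$ and distinct vertices $u,w$, $G(u,w)=1$ if $u,w$ are adjacent and $0$ otherwise. If $G,H_1,\dots,H_k$ are graphs on the same vertex set $V$, $G$ is a (boolean) function of $H_1,\dots,H_k$ if there is a boolean function $f:\{0,1\}^k\to\{0,1\}$ with $G(a,b)=f(H_1(a,b),\dots,H_k(a,b))$ for all distinct $a,b\in V$. A class $\mathcal{Y}$ is a $k$-function of $\mathcal{X}$ if every $G\in\mathcal{Y}$ is a function of at most $k$ graphs from $\mathcal{X}$ (on the vertex set of $G$); $\mathcal{Y}$ is a function of $\mathcal{X}$ if it is a $k$-function for some $k\in\mathbb{N}$. A non-edge is a pair of distinct non-adjacent vertices. *)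

(* Defs.v *)
From HB Require Import structures.
From mathcomp Require Import all_boot.

Set Implicit Arguments.
Unset Strict Implicit.
Unset Printing Implicit Defensive.

Record sgraph (V : finType) := SGraph {
  adj :> rel V;
  adj_sym : symmetric adj;
  adj_irr : irreflexive adj
}.

Section Counting.
Variables (V : finType) (G : sgraph V).

Definition edges : {set {set V}} :=
  [set e | [exists u, exists v, [&& u != v, adj G u v & e == [set u; v]]]].

Definition nonedges : {set {set V}} :=
  [set e | [exists u, exists v, [&& u != v, ~~ adj G u v & e == [set u; v]]]].

End Counting.

Definition isomorphic (V W : finType) (G : sgraph V) (H : sgraph W) : Prop :=
  exists2 f : V -> W, bijective f & forall u v, adj H (f u) (f v) = adj G u v.

Record graph_class := GraphClass {
  in_class :> forall V : finType, sgraph V -> Prop;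
  in_class_iso : forall (V W : finType) (G : sgraph V) (H : sgraph W),
    isomorphic G H -> in_class G -> in_class H
}.

Lemma edges_iso_leq (V W : finType) (G : sgraph V) (H : sgraph W) :
  isomorphic G H -> #|edges H| <= #|edges G|.
Proof.
case=> f [g fK gK] fE.
rewrite -(card_imset (edges H) (imset_inj (can_inj gK))).
apply/subset_leq_card/subsetP => _ /imsetP[e + ->].
rewrite !inE => /existsP[u /existsP[v /and3P[uv Huv /eqP->]]].
apply/existsP; exists (g u); apply/existsP; exists (g v).
by rewrite (inj_eq (can_inj gK)) uv -fE !gK Huv imsetU1 imset_set1 eqxx.
Qed.

Definition E1_mem (V : finType) (G : sgraph V) : Prop := #|edges G| <= 1.

Lemma E1_iso (V W : finType) (G : sgraph V) (H : sgraph W) :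
  isomorphic G H -> E1_mem G -> E1_mem H.
Proof. by move=> /edges_iso_leq; apply: leq_trans. Qed.

Definition E1 : graph_class := GraphClass E1_iso.

Definition bool_function_of (V : finType) (G : sgraph V)
    (k : nat) (H : 'I_k -> sgraph V) : Prop :=
  exists f : {ffun 'I_k -> bool} -> bool,
    forall a b : V, a != b -> adj G a b = f [ffun i => adj (H i) a b].

Definition k_function (k : nat) (Y X : graph_class) : Prop :=
  forall (V : finType) (G : sgraph V), in_class Y G ->
    exists (m : nat) (H : 'I_m -> sgraph V),
      [/\ m <= k, forall i, in_class X (H i) & bool_function_of G H].

Definition function_of (Y X : graph_class) : Prop :=
  exists k : nat, k_function k Y X.

(* Main.v *)
Require Import Defs.
From mathcomp Require Import all_boot.

(** Let [G] be a function [f] of graphs [H_i], and let [c] be the value of [f]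
    at zero. A pair that is an edge of no [H_i] has value [c] in [G], so the
    pairs whose value is not [c] (the edges of [G] if [c] is [false], its
    non-edges if [c] is [true]) are covered by the edge sets of the [H_i].
    Conversely, if [e_1, ..., e_k] are the pairs whose value in [G] is not [c],
    then [G] is the exclusive or of [c] with the disjunction of the [k] graphs
    whose only edge is [e_i]. *)

Set Implicit Arguments.
Unset Strict Implicit.
Unset Printing Implicit Defensive.

Lemma leq_card_bigcup (T I : finType) (P : pred I) (F : I -> {set T}) :
  #|\bigcup_(i | P i) F i| <= \sum_(i | P i) #|F i|.
Proof.
elim/big_ind2: _ => [|A m B n leAm leBn|//]; first by rewrite cards0.
by apply: leq_trans (leq_add leAm leBn); apply: leq_card_setU.
Qed.

Section Deviations.

Variables (V : finType) (G : sgraph V).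
Implicit Types (c : bool) (E : {set {set V}}) (a b : V).

(* By conversion, [deviations false] is [edges G] and [deviations true] is
   [nonedges G]. *)
Definition deviations c : {set {set V}} :=
  [set e | [exists u, exists v,
    [&& u != v, c (+) adj G u v & e == [set u; v]]]].

Lemma deviations_subP c E :
  reflect (forall a b, a != b -> c (+) adj G a b -> [set a; b] \in E)
    (deviations c \subset E).
Proof.
apply: (iffP subsetP) => [sub a b ab Gab|sub e].
  apply: sub; rewrite inE; apply/existsP; exists a; apply/existsP; exists b.
  by rewrite ab Gab eqxx.
by rewrite inE => /existsP[a /existsP[b /and3P[ab Gab /eqP->]]]; apply: sub.
Qed.

Lemma in_deviations c a b :
  a != b -> ([set a; b] \in deviations c) = c (+) adj G a b.
Proof.
move=> ab; apply/idP/idP => [|Gab]; last exact: (deviations_subP c _ _).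
rewrite inE => /existsP[u /existsP[v /and3P[uv Guv /eqP eq_ab]]].
have := set21 u v; have := set22 u v; rewrite -eq_ab.
by case/set2P=> v_ab /set2P[] u_ab; move: uv Guv;
  rewrite u_ab v_ab ?eqxx // adj_sym.
Qed.

Lemma in_edges a b : a != b -> ([set a; b] \in edges G) = adj G a b.
Proof. exact: (in_deviations false). Qed.

End Deviations.

Section GraphOfEdges.

Variables (V : finType) (E : {set {set V}}).

Definition edge_rel : rel V := [rel a b | (a != b) && ([set a; b] \in E)].

Lemma edge_rel_sym : symmetric edge_rel.
Proof. by move=> a b; rewrite /edge_rel /= eq_sym setUC. Qed.

Lemma edge_rel_irr : irreflexive edge_rel.
Proof. by move=> a; rewrite /edge_rel /= eqxx. Qed.

(* Members of [E] that do not have exactly two elements are ignored. *)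
Definition graph_of_edges : sgraph V := SGraph edge_rel_sym edge_rel_irr.

Lemma adj_graph_of_edges (a b : V) :
  a != b -> adj graph_of_edges a b = ([set a; b] \in E).
Proof. by rewrite /= /edge_rel /= => ->. Qed.

Lemma edges_graph_of_edges_sub : edges graph_of_edges \subset E.
Proof.
rewrite -[edges _]/(deviations graph_of_edges false).
by apply/deviations_subP => a b ab; rewrite addFb adj_graph_of_edges.
Qed.

Lemma graph_of_edges_E1 : #|E| <= 1 -> in_class E1 graph_of_edges.
Proof. exact: leq_trans (subset_leq_card edges_graph_of_edges_sub). Qed.

End GraphOfEdges.

Section BooleanFunctions.

Variables (V : finType) (G : sgraph V).

Lemma deviations_bool_function_of (k : nat) (H : 'I_k -> sgraph V) :
  bool_function_of G H ->
  exists c, deviations G c \subset \bigcup_i edges (H i).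
Proof.
case=> f fE; exists (f [ffun=> false]); apply/deviations_subP => a b ab.
rewrite fE //; apply: contraTT => /bigcupP edgeless.
suff -> : [ffun i => adj (H i) a b] = [ffun=> false] by rewrite addbb.
apply/ffunP => i; rewrite !ffunE; apply/negP => Hi.
by apply: edgeless; exists i; rewrite ?in_edges.
Qed.

Lemma card_deviations_bool_function_of_E1 (k : nat) (H : 'I_k -> sgraph V) :
  (forall i, in_class E1 (H i)) -> bool_function_of G H ->
  exists c, #|deviations G c| <= k.
Proof.
move=> HE1 /deviations_bool_function_of[c sub]; exists c.
apply: leq_trans (subset_leq_card sub) _.
apply: leq_trans (leq_card_bigcup _ _) _.
by rewrite -[leqRHS]card_ord -sum1_card; apply: leq_sum => i _; apply: HE1.
Qed.

Lemma bool_function_of_deviations (c : bool) :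
  bool_function_of G
    (fun i : 'I_#|deviations G c| => graph_of_edges [set enum_val i]).
Proof.
exists (fun x => c (+) [exists i, x i]) => a b ab.
apply: (canRL (addKb c)); rewrite -in_deviations //.
apply/idP/existsP => [Dab|[i]]; last first.
  by rewrite ffunE adj_graph_of_edges // inE => /eqP->; apply: enum_valP.
exists (enum_rank_in Dab [set a; b]).
by rewrite ffunE adj_graph_of_edges // inE enum_rankK_in.
Qed.

End BooleanFunctions.

Lemma k_function_E1 (k : nat) (X : graph_class) :
  k_function k X E1 <->
  forall (V : finType) (G : sgraph V), in_class X G ->
    #|edges G| <= k \/ #|nonedges G| <= k.
Proof.
split=> [Xk|few] V G XG.
  have [m [H [le_mk HE1 GH]]] := Xk V G XG.
  have [c le_m] := card_deviations_bool_function_of_E1 HE1 GH.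
  by case: c le_m => /leq_trans/(_ le_mk); [right | left].
have [c le_k] : exists c, #|deviations G c| <= k.
  by case: (few V G XG); [exists false | exists true].
exists #|deviations G c|, (fun i => graph_of_edges [set enum_val i]).
split=> // [i|]; last exact: bool_function_of_deviations.
by apply: graph_of_edges_E1; rewrite cards1.
Qed.

Theorem theorem4p9 (X : graph_class) :
  function_of X E1 <->
  exists t : nat, forall (V : finType) (G : sgraph V), in_class X G ->
    #|edges G| <= t \/ #|nonedges G| <= t.
Proof. by split=> -[t /k_function_E1 Xt]; exists t. Qed.
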